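(* Let $\kappa,\theta,\sigma>0$, $X_0>0$, $T>0$, $\alpha=(4\kappa\theta-\sigma^2)/8$. Let $0=t_0<t_1<\dots<t_N=T$ be a (potentially random) mesh, with $\Delta t_{n+1}=t_{n+1}-t_n$, consisting of $(\mathcal{F}_t)$-stopping times, such that each $\Delta t_{n+1}$ is $\mathcal{F}_{t_n}$-measurable, $N<\infty$ a.s., and there is a deterministic constant $\Delta t_{\max}$ with $\Delta t_n\le \Delta t_{\max}$ for all $n=1,\dots,N$. Let $\{X_n\}$ be the solution of the splitting scheme $$X_{n+1} = e^{-\kappa \Delta t_{n+1}}\left(X_n+2\alpha\Delta t_{n+1}+ \sigma \sqrt{X_n+2\alpha\Delta t_{n+1}}\, \Delta W_{n+1} + \frac{\sigma^2}{4} (\Delta W_{n+1})^2 \right)$$ started from $X_0$, where $\Delta W_{n+1}=W(t_{n+1})-W(t_n)$. Then $$\mathbb{E}\left[X_{N^{(t)}}\right]\leq X_0+\kappa\theta T,\qquad t\in[0,T].$$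
   Context: $W$ is a standard one-dimensional Wiener process with natural filtration $(\mathcal{F}_t)_{t\ge0}$. For a stopping time $\tau$, $\mathcal{F}_\tau=\{B\in\mathcal{F}: B\cap\{\tau\le t\}\in\mathcal{F}_t \text{ for all } t\ge 0\}$. The mesh points are distinct; they may be deterministic or chosen path-dependently (adaptively), in which case $N$ is a random positive integer. For $t\in(0,T]$ the (potentially random) integer $N^{(t)}$ is $$N^{(t)}:=\max\{n\in\mathbb{N}\setminus\{0\} : t_{n-1}<t\},$$ i.e. the index of the right endpoint of the step containing $t$; $N:=N^{(T)}$ and $t_N:=T$. By convention $N^{(0)}:=0$. The scheme is equivalently $X_{n+1}=e^{-\kappa\Delta t_{n+1}}\left(\sqrt{X_n+2\alpha\Delta t_{n+1}}+\tfrac{\sigma}{2}\Delta W_{n+1}\right)^2$. It is understood to be well defined, i.e. $X_n+2\alpha\Delta t_{n+1}\ge 0$ at every step (automatic when $\alpha\ge0$). *)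

(* Defs.v *)
From HB Require Import structures.
From mathcomp Require Import all_boot all_order all_algebra.
From mathcomp Require Import all_classical all_reals all_analysis.

Set Implicit Arguments.
Unset Strict Implicit.
Unset Printing Implicit Defensive.

Import Order.TTheory GRing.Theory Num.Theory.
Import numFieldNormedType.Exports.

Local Open Scope classical_set_scope.
Local Open Scope ring_scope.

(* Processes and filtrations are indexed by R; only times t >= 0 matter, and
   no condition is imposed at negative times. *)

Definition natural_filtration d (Omega : measurableType d) (R : realType)
    (W : R -> Omega -> R) (t : R) : set (set Omega) :=
  <<s \bigcup_(s in `[0, t]) preimage_set_system [set: Omega] (W s) measurable >>.

(* The second argument of normal_prob is the standard deviation. *)
Record wiener_process d (Omega : measurableType d) (R : realType)
    (P : probability Omega R) (W : R -> Omega -> R) : Prop := WienerProcess {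
  wiener_measurable : forall t : R, 0 <= t -> measurable_fun [set: Omega] (W t) ;
  wiener_start : {ae P, forall w, W 0 w = 0} ;
  wiener_continuous : forall w, {within `[0, +oo[, continuous (W ^~ w)} ;
  wiener_increment_law : forall (s t : R) (B : set R), 0 <= s -> s < t ->
    measurable B ->
    P ((W t \- W s) @^-1` B) = normal_prob 0 (Num.sqrt (t - s)) B ;
  wiener_increment_independent :
    forall (s t : R) (A : set Omega) (B : set R),
    0 <= s -> s < t -> natural_filtration W s A -> measurable B ->
    P (A `&` (W t \- W s) @^-1` B) =
      (P A * P ((W t \- W s)%R @^-1` B))%E }.

Definition stopping_time (Omega : Type) (R : realType)
    (F : R -> set (set Omega)) (tau : Omega -> R) : Prop :=
  (forall w, 0 <= tau w) /\ (forall t : R, 0 <= t -> F t [set w | tau w <= t]).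

Definition stopped_sigma_algebra d (Omega : measurableType d) (R : realType)
    (F : R -> set (set Omega)) (tau : Omega -> R) : set (set Omega) :=
  [set B | measurable B /\
           forall t : R, 0 <= t -> F t (B `&` [set w | tau w <= t])].

Definition measurable_wrt (Omega : Type) (R : realType)
    (G : set (set Omega)) (f : Omega -> R) : Prop :=
  forall B : set R, measurable B -> G (f @^-1` B).

Definition mesh_step (Omega : Type) (R : realType)
    (mesh : nat -> Omega -> R) (n : nat) (w : Omega) : R :=
  mesh n.+1 w - mesh n w.

(* The random finite mesh 0 = t_0 < ... < t_N = T is stored as an infinite
   sequence, extended by t_n = T for n > N; thus n < N iff t_n < T, and N is
   finite iff the sequence reaches T. *)
Record adaptive_mesh d (Omega : measurableType d) (R : realType)
    (P : probability Omega R) (F : R -> set (set Omega)) (T : R)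
    (mesh : nat -> Omega -> R) : Prop := AdaptiveMesh {
  mesh_start : forall w, mesh 0%N w = 0 ;
  mesh_increasing : forall n w, mesh n w < T -> mesh n w < mesh n.+1 w ;
  mesh_le_horizon : forall n w, mesh n w <= T ;
  mesh_after_horizon : forall n w, mesh n w = T -> mesh n.+1 w = T ;
  mesh_stopping : forall n, stopping_time F (mesh n) ;
  mesh_step_measurable : forall n,
    measurable_wrt (stopped_sigma_algebra F (mesh n)) (mesh_step mesh n) ;
  mesh_finite : {ae P, forall w, exists n, mesh n w = T} }.

(* N^(t), the largest n >= 1 such that t_(n-1) < t. The default value 0 is
   returned for t = 0, as N^(0) = 0 by convention; otherwise it is returned
   only when N^(t) is infinite. *)
Definition mesh_index (Omega : Type) (R : realType)
    (mesh : nat -> Omega -> R) (t : R) (w : Omega) : nat :=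
  let A := [set n | (0 < n)%N /\ mesh n.-1 w < t] in
  xget 0%N [set n | A n /\ forall m, A m -> (m <= n)%N].

Definition splitting_alpha (R : realType) (kappa theta sigma : R) : R :=
  (4 * kappa * theta - sigma ^+ 2) / 8.

Fixpoint splitting_scheme (Omega : Type) (R : realType)
    (kappa theta sigma x0 : R) (W : R -> Omega -> R)
    (mesh : nat -> Omega -> R) (n : nat) (w : Omega) : R :=
  if n is k.+1 then
    let dt := mesh_step mesh k w in
    let dW := W (mesh k.+1 w) w - W (mesh k w) w in
    let y := splitting_scheme kappa theta sigma x0 W mesh k w
             + 2 * splitting_alpha kappa theta sigma * dt in
    expR (- kappa * dt) *
      (y + sigma * Num.sqrt y * dW + sigma ^+ 2 / 4 * dW ^+ 2)
  else x0.

(* X_n + 2 alpha dt_(n+1) >= 0 for all n < N, almost surely; Num.sqrt is 0 on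
   negative arguments. *)
Definition splitting_well_defined d (Omega : measurableType d) (R : realType)
    (P : probability Omega R) (kappa theta sigma x0 T : R)
    (W : R -> Omega -> R) (mesh : nat -> Omega -> R) : Prop :=
  {ae P, forall w, forall n, mesh n w < T ->
    0 <= splitting_scheme kappa theta sigma x0 W mesh n w
         + 2 * splitting_alpha kappa theta sigma * mesh_step mesh n w}.

(* Main.v *)
Require Import Defs.
From mathcomp Require Import all_boot all_order all_algebra.
From mathcomp Require Import all_classical all_reals all_analysis.
From mathcomp Require Import measurable_realfun ring lra.
Import Order.TTheory GRing.Theory Num.Theory.
Import numFieldNormedType.Exports.
Local Open Scope classical_set_scope.
Local Open Scope ring_scope.

(* With N = N^(t) and Y_n = |X_(min n N)|, one has
   E Y_n <= x0 + kappa theta E t_n by induction on n, and n -> oo is Fatou's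
   lemma. On t_n < t the scheme gives
   X_(n+1) <= (sqrt y + (sigma / 2) dW)^2 with y = X_n + 2 alpha dt, and
   the conditional expectation of the right-hand side given F_(t_n) is at most
   y + (sigma^2 / 4) dt = X_n + kappa theta dt. The latter bound is proved by
   rounding t_n and dt to a grid: both are F_(t_n)-measurable, so the rounded
   increment of W is, on each event of a countable partition, an increment
   between two deterministic times, independent of the past; a second use of
   Fatou's lemma and the continuity of W remove the rounding. Since all
   integrands are non-negative and only upper bounds are needed, no
   integrability has to be known beforehand. *)

(** * Second moment of the centred normal law *)

(** The Radon-Nikodym derivative of [normal_prob m s] and the density [normal_pdf m s] have the same
    integral over every measurable set, so they agree almost everywhere. *)
Lemma ge0_integral_normal_prob {R : realType} (m s : R) (f : R -> \bar R) :
  measurable_fun [set: R] f -> (forall x : R, (0 <= f x)%E) ->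
  (\int[normal_prob m s]_x f x =
   \int[lebesgue_measure]_x (f x * (normal_pdf m s x)%:E))%E.
Proof.
move=> mf f0.
have dom := @normal_prob_dominates R m s.
have mpdf : measurable_fun [set: R] (fun x => (normal_pdf m s x)%:E).
  by apply/measurable_EFinP; exact: measurable_normal_pdf.
rewrite -(Radon_Nikodym_SigmaFinite.change_of_variables dom)//.
have idens := Radon_Nikodym_SigmaFinite.f_integrable dom.
have mdens := measurable_int _ idens.
apply: ge0_ae_eq_integral => //.
- exact: emeasurable_funM.
- exact: emeasurable_funM.
- by move=> x _; rewrite mule_ge0// Radon_Nikodym_SigmaFinite.f_ge0.
- by move=> x _; rewrite mule_ge0// lee_fin normal_pdf_ge0.
- apply: ae_eqe_mul2l; apply: integral_ae_eq => // E _ mE.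
  by rewrite -Radon_Nikodym_SigmaFinite.f_integral.
Qed.

Lemma ge0_integral_lebesgueN {R : realType} (f : R -> \bar R) :
  measurable_fun [set: R] f -> (forall x : R, (0 <= f x)%E) ->
  (\int[lebesgue_measure]_x f (- x)%R = \int[lebesgue_measure]_x f x)%E.
Proof.
move=> mf f0.
transitivity (\int[pushforward lebesgue_measure
    (-%R : R -> measurableTypeR R)]_x f x)%E.
  by rewrite ge0_integral_pushforward// preimage_setT.
apply: eq_measure_integral => A mA _; exact: lebesgue_measureN.
Qed.

Lemma normal_pdf_center0N {R : realType} (s x : R) : s != 0 ->
  normal_pdf 0 s (- x) = normal_pdf 0 s x.
Proof. by move=> s0; rewrite !normal_pdfE// /normal_fun !subr0 sqrrN. Qed.

(* Comparing with the wider density N(0, r s): by 1 + y <= exp y,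
   p_s(x) (1 + (1 - r^-2) x^2 / (2 s^2)) <= r p_(r s)(x). *)
Lemma normal_pdf_widen {R : realType} (s r x : R) : 0 < s -> 1 < r ->
  normal_pdf 0 s x +
    (1 - r ^- 2) / (2 * s ^+ 2) * (x ^+ 2 * normal_pdf 0 s x) <=
  r * normal_pdf 0 (r * s) x.
Proof.
move=> s0 r1; have r0 : 0 < r by lra.
have s1 : s != 0 by rewrite gt_eqF.
have r2 : r != 0 by rewrite gt_eqF.
have peakE : normal_peak s = r * normal_peak (r * s).
  rewrite /normal_peak.
  have -> : (r * s) ^+ 2 * pi *+ 2 = r ^+ 2 * (s ^+ 2 * pi *+ 2) by ring.
  rewrite sqrtrM ?sqr_ge0// sqrtr_sqr gtr0_norm// invfM mulrA divff//.
  by rewrite mul1r.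
rewrite !normal_pdfE ?mulf_neq0//= [in leRHS]mulrA -peakE /normal_fun !subr0.
set y := (1 - r ^- 2) / (2 * s ^+ 2) * x ^+ 2.
have -> : - x ^+ 2 / ((r * s) ^+ 2 *+ 2) = y + - x ^+ 2 / (s ^+ 2 *+ 2).
  by rewrite /y; field; rewrite r2 s1.
rewrite expRD [in leRHS](mulrC (expR y)) [in leRHS]mulrA.
set p := normal_peak s * _.
rewrite mulrA -/y -[X in X + _]mul1r -mulrDl [leRHS]mulrC.
rewrite ler_wpM2r ?expR_ge1Dx// /p mulr_ge0 ?expR_ge0//.
by rewrite normal_peak_ge0.
Qed.

(** Integrating [normal_pdf_widen] gives [1 + c * V <= r] with [c = (1 - r ^- 2) / (2 * s ^+ 2)],
    hence [V <= s ^+ 2 * r ^+ 2 * (2 / (r + 1)) <= s ^+ 2 * r ^+ 2] for every [r > 1]; then [r] is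
    brought close to 1. *)
Lemma integral_sqr_normal_pdf_le {R : realType} (s : R) : 0 < s ->
  (\int[lebesgue_measure]_x (x ^+ 2 * normal_pdf 0 s x)%:E <=
   (s ^+ 2)%:E)%E.
Proof.
move=> s0; set V := integral _ _ _.
have mpdf t : measurable_fun [set: R] (normal_pdf 0 t).
  exact: measurable_normal_pdf.
have mx2 : measurable_fun [set: R]
    (fun x : R => (x ^+ 2 * normal_pdf 0 s x)%:E).
  apply/measurable_EFinP; apply: measurable_funM; last exact: mpdf.
  exact: exprn_measurable.
have mrpdf (r t : R) : measurable_fun [set: R]
    (fun x : R => (r * normal_pdf 0 t x)%:E).
  by apply/measurable_EFinP; apply: measurable_funM.
have V0 : (0 <= V)%E.
  apply: integral_ge0 => x _.
  by rewrite lee_fin mulr_ge0 ?sqr_ge0 ?normal_pdf_ge0.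
have Vr r : 1 < r -> (V <= (s ^+ 2 * r ^+ 2)%:E)%E.
  move=> r1; have r0 : 0 < r by lra.
  have c0 : 0 < (1 - r ^- 2) / (2 * s ^+ 2).
    rewrite divr_gt0 ?mulr_gt0 ?exprn_gt0// subr_gt0 invf_lt1 ?exprn_gt0//.
    by rewrite exprn_egt1.
  have : ((1 + ((1 - r ^- 2) / (2 * s ^+ 2))%:E * V) <= r%:E)%E.
    rewrite -(@integral_normal_pdf R 0 s) -ge0_integralZl//=; last 2 first.
      - by move=> x _; rewrite lee_fin mulr_ge0 ?sqr_ge0 ?normal_pdf_ge0.
      - by rewrite lee_fin ltW.
    rewrite -ge0_integralD//=; last 4 first.
      - by move=> x _; rewrite lee_fin normal_pdf_ge0.
      - by apply/measurable_EFinP; exact: mpdf.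
      - move=> x _; rewrite -EFinM lee_fin (mulr_ge0 (ltW c0))//.
        by rewrite mulr_ge0 ?sqr_ge0 ?normal_pdf_ge0.
      - exact: measurable_funeM.
    have -> : (r%:E =
        \int[lebesgue_measure]_x (r * normal_pdf 0 (r * s) x)%:E)%E.
      under eq_integral do rewrite EFinM.
      rewrite ge0_integralZl//= ?integral_normal_pdf ?mule1//.
      - by apply/measurable_EFinP; exact: mpdf.
      - by move=> x _; rewrite lee_fin normal_pdf_ge0.
      - by rewrite lee_fin ltW.
    apply: ge0_le_integral => //=.
    - move=> x _; rewrite -EFinM -EFinD lee_fin.
      rewrite addr_ge0 ?normal_pdf_ge0// (mulr_ge0 (ltW c0))//.
      by rewrite mulr_ge0 ?sqr_ge0 ?normal_pdf_ge0.
    - apply: emeasurable_funD; last exact: measurable_funeM.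
      by apply/measurable_EFinP; exact: mpdf.
    - exact: mrpdf.
    - by move=> x _; rewrite -EFinM -EFinD lee_fin normal_pdf_widen.
  (* Since [c0] makes the coefficient positive, an infinite [V] would make the left-hand side
     infinite. *)
  move: V0; case: V => [v| |]//; last by rewrite gt0_muley ?lte_fin.
  rewrite -EFinM -EFinD !lee_fin => v0 h.
  have h1 : (1 - r ^- 2) / (2 * s ^+ 2) * v <= r - 1 by lra.
  have : v <= (r - 1) / ((1 - r ^- 2) / (2 * s ^+ 2)).
    by rewrite ler_pdivlMr// mulrC.
  move/le_trans; apply.
  have -> : (r - 1) / ((1 - r ^- 2) / (2 * s ^+ 2)) =
      s ^+ 2 * r ^+ 2 * (2 / (r + 1)).
    field; rewrite !gt_eqF//=; try lra.
    by rewrite subr_gt0 exprn_egt1.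
  rewrite -[leRHS]mulr1 ler_wpM2l// ?(mulr_ge0 (sqr_ge0 _) (sqr_ge0 _))//.
  by rewrite ler_pdivrMr; lra.
move: V0 Vr; case: V => [v| |]//; last first.
  by move=> _ /(_ 2); rewrite ltr1n => /(_ isT).
rewrite lee_fin => v0 Vr; rewrite lee_fin.
have s20 : 0 < s ^+ 2 by rewrite exprn_gt0.
rewrite leNgt; apply/negP => sv.
(* The midpoint of 1 and [v / s ^+ 2]: with [r ^+ 2 = r2] the bound reads [v <= s ^+ 2 * r2], which
   is less than [v]. *)
pose r2 := (v / s ^+ 2 + 1) / 2.
have q1 : 1 < v / s ^+ 2 by rewrite ltr_pdivlMr// mul1r.
have := Vr (Num.sqrt r2); rewrite sqr_sqrtr; last by rewrite /r2; lra.
have -> : 1 < Num.sqrt r2.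
  by rewrite -[ltLHS]sqrtr1 ltr_sqrt /r2; lra.
move=> /(_ isT); rewrite lee_fin leNgt => /negP; apply.
rewrite mulrC -ltr_pdivlMr// /r2; lra.
Qed.

(** The law is symmetric, so [J] is unchanged when [b] becomes [- b]; in [J + J] the cross terms
    cancel under the integral sign, and the first moment never has to be computed. *)
Lemma normal_second_moment_le {R : realType} (s u b : R) : 0 < s ->
  (\int[normal_prob 0 s]_x ((u + b * x) ^+ 2)%:E <=
   (u ^+ 2 + b ^+ 2 * s ^+ 2)%:E)%E.
Proof.
move=> s0.
have mpdf : measurable_fun [set: R] (normal_pdf 0 s).
  exact: measurable_normal_pdf.
have p0 := @normal_pdf_ge0 R 0 s.
have mq (c : R) : measurable_fun [set: R]
    (fun x : R => ((u + c * x) ^+ 2 * normal_pdf 0 s x)%:E).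
  apply/measurable_EFinP; apply: measurable_funM => //.
  by apply: measurable_funX; apply: measurable_funD => //;
    exact: measurable_funM.
have q0 (c x : R) : (0 <= ((u + c * x) ^+ 2 * normal_pdf 0 s x)%:E)%E.
  by rewrite lee_fin mulr_ge0 ?sqr_ge0.
rewrite ge0_integral_normal_prob//; last 2 first.
  - apply/measurable_EFinP; apply: measurable_funX.
    by apply: measurable_funD => //; exact: measurable_funM.
  - by move=> x; rewrite lee_fin sqr_ge0.
under eq_integral do rewrite -EFinM.
set J := integral _ _ _.
have JN : J = (\int[lebesgue_measure]_x
    ((u + (- b) * x) ^+ 2 * normal_pdf 0 s x)%:E)%E.
  rewrite -(ge0_integral_lebesgueN _ (mq (- b)) (q0 (- b))).
  apply: eq_integral => x _ /=.
  by rewrite normal_pdf_center0N ?gt_eqF// mulrNN.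
have J2 : (J + J <= (2 * (u ^+ 2 + b ^+ 2 * s ^+ 2))%:E)%E.
  rewrite {2}JN -ge0_integralD//=; last 2 first.
    - exact: mq.
    - exact: mq.
  rewrite [X in (X <= _)%E](_ : _ = \int[lebesgue_measure]_x
     ((2 * u ^+ 2)%:E * (normal_pdf 0 s x)%:E +
      (2 * b ^+ 2)%:E * (x ^+ 2 * normal_pdf 0 s x)%:E))%E; last first.
    by apply: eq_integral => x _; rewrite -!EFinM -!EFinD; congr EFin; ring.
  have mx2 : measurable_fun [set: R]
      (fun x : R => (x ^+ 2 * normal_pdf 0 s x)%:E).
    apply/measurable_EFinP; apply: measurable_funM; last exact: mpdf.
    exact: exprn_measurable.
  have x20 (x : R) : (0 <= (x ^+ 2 * normal_pdf 0 s x)%:E)%E.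
    by rewrite lee_fin mulr_ge0 ?sqr_ge0.
  have c0 (c : R) : (0 <= (2 * c ^+ 2)%:E)%E.
    by rewrite lee_fin mulr_ge0 ?sqr_ge0.
  have mp : measurable_fun [set: R] (fun x : R => (normal_pdf 0 s x)%:E).
    exact/measurable_EFinP.
  have pE0 x : (0 <= (normal_pdf 0 s x)%:E)%E by rewrite lee_fin.
  rewrite ge0_integralD//=; last 4 first.
    - by move=> x _; rewrite mule_ge0.
    - exact: measurable_funeM mp.
    - by move=> x _; rewrite mule_ge0.
    - exact: measurable_funeM mx2.
  rewrite !ge0_integralZl//=.
  rewrite integral_normal_pdf mule1 mulrDr EFinD leeD2l// mulrA [leRHS]EFinM.
  by rewrite lee_wpmul2l ?integral_sqr_normal_pdf_le.
have J0 : (0 <= J)%E by apply: integral_ge0.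
case: J J0 J2 {JN} => [j| |]//.
by rewrite -EFinD !lee_fin => _; lra.
Qed.

(** * Increments of the Wiener process *)

Definition past_generators {Omega : Type} {R : realType} (W : R -> Omega -> R)
    (t : R) : set (set Omega) :=
  \bigcup_(s in `[0, t]) preimage_set_system [set: Omega] (W s) measurable.

(* Omega equipped with the sigma-algebra F_t; its measurable sets are
   convertible to natural_filtration W t. *)
Notation past W t := (g_sigma_algebraType (past_generators W t)).

Lemma past_le {d} {Omega : measurableType d} {R : realType}
    {W : R -> Omega -> R} {s t : R} {A : set Omega} :
  s <= t -> measurable (A : set (past W s)) -> measurable (A : set (past W t)).
Proof.
move=> st; apply: sub_sigma_algebra2 => _ [r rs [B mB <-]].
exists r; last by exists B.
by move: rs; rewrite /= !in_itv/= => /andP[-> /le_trans ->].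
Qed.

Lemma past_measurable {d} {Omega : measurableType d} {R : realType}
    {W : R -> Omega -> R} {s : R} {A : set Omega} :
  (forall t, 0 <= t -> measurable_fun [set: Omega] (W t)) ->
  measurable (A : set (past W s)) -> measurable A.
Proof.
move=> mW; apply: smallest_sub; first exact: sigma_algebra_measurable.
move=> _ [r + [B mB <-]]; rewrite /= in_itv/= => /andP[r0 _].
exact: mW.
Qed.

Lemma measurable_fun_past {d} {Omega : measurableType d} {R : realType}
    {W : R -> Omega -> R} {d'} {V : measurableType d'} {s : R} {D : set Omega}
    {f : Omega -> V} :
  (forall t, 0 <= t -> measurable_fun [set: Omega] (W t)) ->
  measurable (D : set (past W s)) ->
  measurable_fun (D : set (past W s)) f -> measurable_fun D f.
Proof. by move=> mW mD mf _ B mB; apply: past_measurable (mf mD B mB). Qed.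

(** The identity from [Omega] to [past W s] carries all of F_s. By independence its joint law with
    the increment is a product, and Tonelli reduces the claim to the normal second moment with [U w]
    frozen. *)
Lemma wiener_increment_second_moment_le {d} {Omega : measurableType d}
    {R : realType} {P : probability Omega R} {W : R -> Omega -> R}
    (hW : wiener_process P W) (s t b : R) (B : set Omega) (U : Omega -> R) :
  0 <= s -> s < t ->
  measurable (B : set (past W s)) -> measurable_fun (B : set (past W s)) U ->
  (\int[P]_(w in B) ((U w + b * (W t w - W s w)) ^+ 2)%:E <=
   \int[P]_(w in B) (U w ^+ 2 + b ^+ 2 * (t - s))%:E)%E.
Proof.
move=> s0 st mB mU.
have mW := wiener_measurable hW.
have mW2 : measurable_fun [set: Omega] (fun w => W t w - W s w).
  by apply: measurable_funB; apply: mW => //; rewrite ltW// (le_lt_trans s0).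
pose F := past W s.
have mid : measurable_fun [set: Omega] (id : Omega -> F).
  by move=> _ A mA; rewrite setTI; exact: past_measurable mA.
have mphi : measurable_fun [set: Omega] 
    (fun w => (w : F, (W t w - W s w : measurableTypeR R))).
  exact: measurable_fun_pair.
pose X : {mfun Omega >-> F} := mfun_Sub (mem_set mid).
pose Phi : {mfun Omega >-> (F * measurableTypeR R)%type} :=
  mfun_Sub (mem_set mphi).
pose m1 := distribution P X.
pose N := normal_prob 0 (Num.sqrt (t - s)).
(* Product measures are determined by rectangles, and on a rectangle this is independence together
   with the law of the increment. *)
have joint A : measurable A -> (m1 \x N)%E A = distribution P Phi A.
  apply: product_measure_unique => A1 A2 mA1 mA2.
  rewrite /distribution /pushforward /= -(wiener_increment_law hW)//.
  by rewrite -(wiener_increment_independent hW).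
(* [U] is measurable only on [B]; its extension by 0 is measurable everywhere, and the factor [\1_B]
   in [g] hides the change. *)
pose U' : F -> R := U \_ B.
have mU' : measurable_fun [set: F] U'.
  by apply/(measurable_restrictT _ mB).
pose g (z : (F * measurableTypeR R)%type) : \bar R :=
  (\1_B z.1 * (U' z.1 + b * z.2) ^+ 2)%:E.
have g0 z : (0 <= g z)%E by rewrite lee_fin mulr_ge0// sqr_ge0.
have m1B : measurable_fun [set: F] (\1_B : F -> R) by exact: measurable_indic.
have mg : measurable_fun [set: (F * measurableTypeR R)%type] g.
  apply/measurable_EFinP; apply: measurable_funM.
    exact: (measurableT_comp m1B measurable_fst).
  apply: measurable_funX; apply: measurable_funD.
    exact: (measurableT_comp mU' measurable_fst).
  by apply: measurable_funM => //; exact: measurable_snd.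
have mU2 : measurable_fun [set: F]
    (fun w => (\1_B w * (U' w ^+ 2 + b ^+ 2 * (t - s)))%:E).
  apply/measurable_EFinP; apply: measurable_funM => //.
  by apply: measurable_funD => //; exact: measurable_funX.
have ts0 : 0 < t - s by rewrite subr_gt0.
have h0 x : 0 <= \1_B x * (U' x ^+ 2 + b ^+ 2 * (t - s)).
  by rewrite mulr_ge0// addr_ge0 ?sqr_ge0// mulr_ge0 ?sqr_ge0// ltW.
have restrictE (h : Omega -> R) : (\int[P]_(w in B) (h w)%:E =
    \int[P]_w (\1_B w * h w)%:E)%E.
  rewrite integral_mkcond; apply: eq_integral => w _.
  by rewrite patchE indicE; case: ifP; rewrite ?mul1r ?mul0r.
have U'E w (h : R -> R) : \1_B w * h (U' w) = \1_B w * h (U w).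
  by rewrite /U' indicE patchE; case: ifP => _; rewrite ?mul0r.
have -> : (\int[P]_(w in B) ((U w + b * (W t w - W s w)) ^+ 2)%:E =
    \int[distribution P Phi]_z g z)%E.
  rewrite ge0_integral_distribution// restrictE; apply: eq_integral => w _ /=.
  by rewrite /g/= (U'E w (fun u => (u + b * (W t w - W s w)) ^+ 2)).
have -> : (\int[P]_(w in B) (U w ^+ 2 + b ^+ 2 * (t - s))%:E =
    \int[m1]_w (\1_B w * (U' w ^+ 2 + b ^+ 2 * (t - s)))%:E)%E.
  rewrite ge0_integral_distribution// restrictE; apply: eq_integral => w _ /=.
  by rewrite (U'E w (fun u => u ^+ 2 + b ^+ 2 * (t - s))).
have -> : (\int[distribution P Phi]_z g z = \int[(m1 \x N)%E]_z g z)%E.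
  by apply: eq_measure_integral => A mA _; exact/esym/joint.
rewrite fubini_tonelli1//.
apply: ge0_le_integral => //.
- by move=> w _; exact: integral_ge0.
- exact: measurable_fun_fubini_tonelli_F.
move=> w _; rewrite /fubini_F /g/= .
under eq_integral do rewrite EFinM.
have mq : measurable_fun [set: R] (fun x : R => ((U' w + b * x) ^+ 2)%:E).
  apply/measurable_EFinP; apply: measurable_funX.
  by apply: measurable_funD => //; exact: measurable_funM.
rewrite ge0_integralZl ?lee_fin//; last first.
  by move=> x _; rewrite lee_fin sqr_ge0.
rewrite [leRHS]EFinM lee_wpmul2l// ?lee_fin//.
(* The parameter of [normal_prob] is a standard deviation, so the variance [t - s] is written as a
   square. *)
rewrite -[X in b ^+ 2 * X](sqr_sqrtr (ltW ts0)).
by apply: normal_second_moment_le; rewrite sqrtr_gt0.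
Qed.

(** * Fatou's lemma, countable partitions and rounding to a grid *)

Lemma ge0_integral_le_cvg {d} {T : measurableType d} {R : realType}
    (mu : {measure set T -> \bar R}) (D : set T) (f_ : (T -> \bar R)^nat)
    (f : T -> \bar R) (c_ : (\bar R)^nat) (c : \bar R) :
  measurable D -> (forall n, measurable_fun D (f_ n)) ->
  (forall n x, D x -> (0 <= f_ n x)%E) ->
  (forall x, D x -> f_ ^~ x @ \oo --> f x) ->
  (forall n, (\int[mu]_(x in D) f_ n x <= c_ n)%E) -> c_ @ \oo --> c ->
  (\int[mu]_(x in D) f x <= c)%E.
Proof.
move=> mD mf f0 ff fc cc.
have -> : (\int[mu]_(x in D) f x =
    \int[mu]_(x in D) limn_einf (f_ ^~ x))%E.
  apply: eq_integral => x /[!inE] Dx.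
  rewrite is_cvg_limn_einfE; last by apply/cvg_ex; exists (f x); exact: ff.
  by apply/esym/cvg_lim => //; exact: ff.
(* Only non-negativity is used, no domination. The infimum of the integrals over the tail from [n]
   on is at most the [n]-th integral, hence at most [c_ n]. *)
apply: (le_trans (fatou mu mD mf f0)).
rewrite limn_einf_lim -(cvg_lim _ cc)//; apply: lee_lim.
- exact: is_cvg_einfs.
- by apply/cvg_ex; exists c.
- apply: nearW => n; apply: (le_trans _ (fc n)).
  by apply: ereal_inf_lbound; exists n => /=.
Qed.

Lemma ge0_le_integral_partition {d} {T : measurableType d} {R : realType}
    (mu : {measure set T -> \bar R}) (D : set T) (k : T -> nat)
    (f g : T -> \bar R) :
  (forall i, measurable (D `&` k @^-1` [set i])) ->
  measurable_fun D f -> measurable_fun D g ->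
  (forall x, D x -> (0 <= f x)%E) -> (forall x, D x -> (0 <= g x)%E) ->
  (forall i, (\int[mu]_(x in D `&` k @^-1` [set i]) f x <=
              \int[mu]_(x in D `&` k @^-1` [set i]) g x)%E) ->
  (\int[mu]_(x in D) f x <= \int[mu]_(x in D) g x)%E.
Proof.
move=> mDk mf mg f0 g0 fg.
have DE : D = \bigcup_i (D `&` k @^-1` [set i]).
  by apply/seteqP; split => [x Dx|x [i _ [Dx _]]//]; exists (k x).
have tDk : trivIset [set: nat] (fun i => D `&` k @^-1` [set i]).
  by move=> i j _ _ [x [[_ <-] [_ <-]]].
rewrite DE ge0_integral_bigcup ?ge0_integral_bigcup -?DE//.
apply: lee_nneseries => // i _ _.
by apply: integral_ge0 => x [Dx _]; exact: f0.
Qed.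

(** Meant for [W] evaluated at a random time with countably many values: on each cell of the index
    it coincides with [W] at a fixed time. *)
Lemma measurable_fun_nat_index {d} {T : measurableType d}
    {d'} {V : measurableType d'} (D : set T)
    (k : T -> nat) (g : nat -> T -> V) :
  (forall i, measurable (D `&` k @^-1` [set i])) ->
  (forall i, measurable_fun (D `&` k @^-1` [set i]) (g i)) ->
  measurable_fun D (fun x => g (k x) x).
Proof.
move=> mDk mg.
have -> : D = \bigcup_i (D `&` k @^-1` [set i]).
  by apply/seteqP; split => [x Dx|x [i _ [Dx _]]//]; exists (k x).
apply/measurable_fun_bigcup => // i.
by apply: eq_measurable_fun (mg i) => x /[!inE] -[_ /= <-].
Qed.

(** The first point of the grid of mesh [1 / (m + 1)] strictly to the right of a non-negative [x].
    Strictness keeps a rounded time step positive even when the step itself is 0. *)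
Definition grid_right {R : realType} (m : nat) (x : R) : R :=
  (Num.truncn (x * m.+1%:R)).+1%:R / m.+1%:R.

Lemma grid_right_gt {R : realType} (m : nat) (x : R) : x < grid_right m x.
Proof. by rewrite ltr_pdivlMr// truncnS_gt. Qed.

Lemma grid_right_le {R : realType} (m : nat) (x : R) :
  0 <= x -> grid_right m x <= x + m.+1%:R^-1.
Proof.
move=> x0; rewrite ler_pdivrMr// mulrDl mulVf// -natr1 lerD2r.
by rewrite truncn_le mulr_ge0.
Qed.

Lemma cvg_grid_right {R : realType} (x : R) :
  0 <= x -> grid_right ^~ x @ \oo --> x.
Proof.
move=> x0; apply: (@squeeze_cvgr _ _ _ _ (cst x) (fun m => x + harmonic m)).
- by apply: nearW => m /=; rewrite (ltW (grid_right_gt _ _)) grid_right_le.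
- exact: cvg_cst.
- rewrite -[X in _ --> X]addr0.
  by apply: cvgD; [exact: cvg_cst|exact: cvg_harmonic].
Qed.

Lemma measurable_truncn_fiber {d} {T : measurableType d} {R : realType}
    (D : set T) (f : T -> R) (m i : nat) :
  measurable D -> measurable_fun D f -> (forall x, D x -> 0 <= f x) ->
  measurable (D `&` (fun x => Num.truncn (f x * m.+1%:R)) @^-1` [set i]).
Proof.
move=> mD mf f0.
have mfm : measurable_fun D (fun x => f x * m.+1%:R).
  by apply: measurable_funM.
rewrite (_ : _ `&` _ = D `&` (fun x => f x * m.+1%:R) @^-1` `[i%:R, i.+1%:R[).
  exact: mfm.
apply/seteqP; split => x [Dx /=] h; split => //=.
  rewrite in_itv/= -truncn_eq ?h// mulr_ge0//; exact: f0.
by apply/eqP; rewrite truncn_eq ?mulr_ge0 ?f0//; move: h; rewrite in_itv.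
Qed.

(** * Increments over random time intervals *)

Lemma wiener_path_cvg {d} {Omega : measurableType d} {R : realType}
    {P : probability Omega R} {W : R -> Omega -> R} (hW : wiener_process P W)
    (w : Omega) (u : R^nat) (l : R) :
  (forall n, 0 <= u n) -> 0 <= l -> u @ \oo --> l ->
  (fun n => W (u n) w) @ \oo --> W l w.
Proof.
move=> u0 l0 ul.
move: (@wiener_continuous _ _ _ _ _ hW w) => /subspace_continuousP/(_ l).
rewrite /= in_itv/= andbT => /(_ l0) cW.
apply: (cvg_comp u (W ^~ w)) cW => A nA.
apply: (@filterS _ \oo _ (u @^-1` _) (u @^-1` A) _ (ul _ nA)) => n.
by apply; rewrite /= in_itv/= u0.
Qed.

(* f is F_S-measurable *)
Definition stopped_measurable {d} {Omega : measurableType d} {R : realType}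
    (W : R -> Omega -> R) (S : Omega -> R) {d'} {V : measurableType d'}
    (f : Omega -> V) :=
  forall u : R, 0 <= u ->
    measurable_fun ([set w | S w <= u] : set (past W u)) f.

Lemma stopped_measurable_wrt {d} {Omega : measurableType d} {R : realType}
    {W : R -> Omega -> R} {S f : Omega -> R} :
  measurable_wrt (stopped_sigma_algebra (natural_filtration W) S) f ->
  stopped_measurable W S f.
Proof. by move=> mf u u0 _ B /mf[_ /(_ u u0)]; rewrite setIC. Qed.

Lemma stopped_measurable_time {d} {Omega : measurableType d} {R : realType}
    {W : R -> Omega -> R} {S : Omega -> R} :
  stopping_time (natural_filtration W) S -> stopped_measurable W S S.
Proof.
move=> [S0 mS] u u0 mD.
apply: (measurability _ (RGenOInfty.measurableE R)) => //.
move=> /= _ [_ [a ->] <-]; rewrite preimage_itvoy.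
(* Stopping times are constrained at times [>= 0] only, so a negative level [a] is treated apart;
   there the condition [a < S w] is vacuous. *)
have [a0|a0] := ltP a 0.
  rewrite (_ : _ `&` _ = [set w | S w <= u])//.
  apply/seteqP; split => [w []//|w Sw]; split => //=.
  exact: lt_le_trans (S0 w).
rewrite (_ : _ `&` _ = [set w | S w <= u] `\` [set w | S w <= Num.min u a]).
  apply: measurableD => //; apply: (past_le _ (mS (Num.min u a) _)).
    by rewrite ge_min lexx.
  by rewrite le_min u0.
apply/seteqP; split => [w [/= Su aS]|w [/= Su]].
  by split => //=; rewrite le_min Su/=; apply/negP; rewrite -ltNge.
by rewrite le_min Su/= => /negP; rewrite -ltNge.
Qed.

Lemma stopped_measurable_le {d} {Omega : measurableType d} {R : realType}
    {W : R -> Omega -> R} {S S' : Omega -> R} {d'} {V : measurableType d'}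
    {f : Omega -> V} :
  stopping_time (natural_filtration W) S -> (forall w, S w <= S' w) ->
  stopped_measurable W S f -> stopped_measurable W S' f.
Proof.
move=> [_ mS] SS' mf u u0; apply: measurable_funS (mf u u0); first exact: mS.
by move=> w /=; apply: le_trans (SS' w).
Qed.

Lemma measurable_past {d} {Omega : measurableType d} {R : realType}
    (W : R -> Omega -> R) (r u : R) (B : set R) :
  0 <= r -> r <= u -> measurable B -> natural_filtration W u (W r @^-1` B).
Proof.
move=> r0 ru mB; apply: sub_sigma_algebra; exists r.
  by rewrite /= in_itv/= r0.
by exists B => //; rewrite setTI.
Qed.

(** [W] at the rounded time converges to [W] at [S] by continuity of paths. Rounding up may pass [u]
    and leave F_u, hence the cap [Num.min u], which is harmless in the limit because [S w <= u]. *)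
Lemma stopped_measurable_wiener {d} {Omega : measurableType d} {R : realType}
    {P : probability Omega R} {W : R -> Omega -> R} (hW : wiener_process P W)
    {S : Omega -> R} :
  stopping_time (natural_filtration W) S ->
  stopped_measurable W S (fun w => W (S w) w).
Proof.
move=> hS u u0; have mS := stopped_measurable_time hS u u0.
have [S0 /(_ u u0) mD] := hS.
apply: (@measurable_fun_cvg _ (past W u) R [set w | S w <= u]
  (fun m w => W (Num.min u (grid_right m (S w))) w)).
  move=> m; apply: (measurable_fun_nat_index
      ([set w | S w <= u] : set (past W u))
      (fun w => Num.truncn (S w * m.+1%:R))
      (fun i => W (Num.min u (i.+1%:R / m.+1%:R)))).
  - by move=> i; apply: measurable_truncn_fiber.
  - move=> i; apply: (@measurable_funS _ _ (past W u) R setT) => //.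
    move=> _ B mB; rewrite setTI; apply: measurable_past => //.
      by rewrite le_min u0 divr_ge0.
    by rewrite ge_min lexx.
move=> w /= Su; apply: (wiener_path_cvg hW) => //.
  by move=> m; rewrite le_min u0 (le_trans (S0 w))// ltW// grid_right_gt.
apply: (@squeeze_cvgr _ _ _ _ (cst (S w)) (grid_right ^~ (S w))).
- apply: nearW => m /=.
  by rewrite le_min Su (ltW (grid_right_gt _ _)) ge_min lexx orbT.
- exact: cvg_cst.
- exact: cvg_grid_right.
Qed.

Lemma stopped_measurable_bounded {d} {Omega : measurableType d} {R : realType}
    {W : R -> Omega -> R} {S : Omega -> R} {T : R}
    {d'} {V : measurableType d'} {f : Omega -> V} :
  (forall t, 0 <= t -> measurable_fun [set: Omega] (W t)) ->
  0 <= T -> (forall w, S w <= T) -> stopped_measurable W S f ->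
  measurable_fun [set: Omega] f.
Proof.
move=> mW T0 ST /(_ T T0) mf.
have DE : [set w | S w <= T] = [set: Omega] by apply/seteqP; split => // w _ /=.
by rewrite DE in mf; apply: measurable_fun_past mW _ mf; exact: measurableT.
Qed.

Lemma stopped_increment_second_moment_le {d} {Omega : measurableType d}
    {R : realType} {P : probability Omega R} {W : R -> Omega -> R}
    (hW : wiener_process P W) {S dt a : Omega -> R} {A : set Omega} {b T : R} :
  stopping_time (natural_filtration W) S -> 0 <= T -> (forall w, S w <= T) ->
  (forall w, 0 <= dt w) -> stopped_measurable W S dt ->
  stopped_measurable W S a ->
  (forall u, 0 <= u -> natural_filtration W u ([set w | S w <= u] `&` A)) ->
  (\int[P]_(w in A) ((a w + b * (W (S w + dt w) w - W (S w) w)) ^+ 2)%:E <=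
   \int[P]_(w in A) (a w ^+ 2 + b ^+ 2 * dt w)%:E)%E.
Proof.
move=> hS T0 ST dt0 mdt ma mA.
have mW := @wiener_measurable _ _ _ _ _ hW.
have [S0 mSu] := hS.
have mS := stopped_measurable_time hS.
have mS' : measurable_fun [set: Omega] S.
  exact: stopped_measurable_bounded mW T0 ST mS.
have mdt' : measurable_fun [set: Omega] dt.
  exact: stopped_measurable_bounded mW T0 ST mdt.
have ma' : measurable_fun [set: Omega] a.
  exact: stopped_measurable_bounded mW T0 ST ma.
have mA' : measurable A.
  have -> : A = [set w | S w <= T] `&` A.
    by apply/seteqP; split => w; [split => //=|case].
  exact: past_measurable mW (mA T T0).
pose k m w := Num.truncn (S w * m.+1%:R).
pose l m w := Num.truncn (dt w * m.+1%:R).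
pose gS m w := grid_right m (S w).
pose gd m w := grid_right m (dt w).
have gS0 m w : 0 <= gS m w by rewrite (le_trans (S0 w))// ltW// grid_right_gt.
have gd0 m w : 0 <= gd m w by rewrite (le_trans (dt0 w))// ltW// grid_right_gt.
have mk m i (D : set Omega) : measurable D ->
    measurable (D `&` k m @^-1` [set i]).
  by move=> mD; apply: measurable_truncn_fiber => //; exact: measurable_funTS.
have ml m i (D : set Omega) : measurable D ->
    measurable (D `&` l m @^-1` [set i]).
  by move=> mD; apply: measurable_truncn_fiber => //; exact: measurable_funTS.
have mWS m : measurable_fun A (fun w => W (gS m w) w).
  apply: (measurable_fun_nat_index A (k m) (fun i => W (i.+1%:R / m.+1%:R))).
    by move=> i; exact: mk.
  by move=> i; apply: measurable_funTS; apply: mW; rewrite divr_ge0.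
have mgd m : measurable_fun A (gd m).
  apply: (measurable_fun_nat_index A (l m) 
    (fun i _ => i.+1%:R / m.+1%:R : R)).
    by move=> i; exact: ml.
  by move=> i; exact: measurable_cst.
have mWSd m : measurable_fun A (fun w => W (gS m w + gd m w) w).
  apply: (measurable_fun_nat_index A (k m)
    (fun i w => W (i.+1%:R / m.+1%:R + gd m w) w)).
    by move=> i; exact: mk.
  move=> i; apply: (measurable_fun_nat_index _ (l m)
    (fun j => W (i.+1%:R / m.+1%:R + j.+1%:R / m.+1%:R))).
    by move=> j; apply: ml; exact: mk.
  by move=> j; apply: measurable_funTS; apply: mW; rewrite addr_ge0 ?divr_ge0.
(* The start and the length are rounded separately, so that both end points of the increment are
   deterministic on each cell. *)
pose f m w := ((a w + b * (W (gS m w + gd m w) w - W (gS m w) w)) ^+ 2)%:E.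
have mf m : measurable_fun A (f m).
  apply/measurable_EFinP; apply: measurable_funX; apply: measurable_funD.
    exact: measurable_funTS.
  by apply: measurable_funM => //; exact: measurable_funB.
have mg (h : Omega -> R) : measurable_fun A h ->
    measurable_fun A (fun w => (a w ^+ 2 + b ^+ 2 * h w)%:E).
  move=> mh; apply/measurable_EFinP; apply: measurable_funD.
    by apply: measurable_funX; exact: measurable_funTS.
  exact: measurable_funM.
have g0 (h : Omega -> R) w : 0 <= h w -> (0 <= (a w ^+ 2 + b ^+ 2 * h w)%:E)%E.
  by move=> h0; rewrite lee_fin addr_ge0 ?sqr_ge0// mulr_ge0 ?sqr_ge0.
have step m : (\int[P]_(w in A) f m w <=
    \int[P]_(w in A) (a w ^+ 2 + b ^+ 2 * gd m w)%:E)%E.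
  apply: (ge0_le_integral_partition _ _ (k m)) => //.
  - by move=> i; exact: mk.
  - exact: mg.
  - by move=> w _; rewrite lee_fin sqr_ge0.
  - by move=> w _; exact: g0.
  move=> i; have mAk := mk m i A mA'.
  apply: (ge0_le_integral_partition _ _ (l m)) => //.
  - by move=> j; exact: ml.
  - exact: measurable_funS (mf m).
  - by apply: measurable_funS (mg _ (mgd m)).
  - by move=> w _; rewrite lee_fin sqr_ge0.
  - by move=> w _; exact: g0.
  move=> j; set B := A `&` _ `&` _.
  pose s : R := i.+1%:R / m.+1%:R; pose h : R := j.+1%:R / m.+1%:R.
  have h0 : 0 < h by rewrite divr_gt0.
  have s0 : 0 <= s by rewrite divr_ge0.
  have gSE w : B w -> gS m w = s.
    by move=> [[_ /= ki] _]; rewrite /gS /grid_right -/(k m w) ki.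
  have gdE w : B w -> gd m w = h.
    by move=> [_ /= lj]; rewrite /gd /grid_right -/(l m w) lj.
  (* On [B] the time [S] lies strictly before its rounded value [s]. Hence intersecting with
     [S w <= s] loses nothing, and it brings each F_S-measurable piece into F_s. *)
  have mB : measurable (B : set (past W s)).
    rewrite (_ : B = ([set w | S w <= s] `&` A) `&`
        (([set w | S w <= s] `&` k m @^-1` [set i]) `&`
         ([set w | S w <= s] `&` l m @^-1` [set j]))).
      apply: measurableI; first exact: mA.
      apply: measurableI; apply: measurable_truncn_fiber => //.
      - exact: mSu.
      - exact: mS.
      - exact: mSu.
      - exact: mdt.
    apply/seteqP; split => w; last by move=> [[_ ?] [[_ ?] [_ ?]]].
    move=> Bw; have Ss : S w <= s by rewrite -(gSE w Bw) ltW// grid_right_gt.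
    by case: Bw => -[? ?] ?.
  have : (\int[P]_(w in B) ((a w + b * (W (s + h) w - W s w)) ^+ 2)%:E <=
      \int[P]_(w in B) (a w ^+ 2 + b ^+ 2 * ((s + h) - s))%:E)%E.
    apply: (wiener_increment_second_moment_le hW) => //; first by rewrite ltrDl.
    apply: (@measurable_funS _ _ (past W s) R [set w | S w <= s]) => //.
    - exact: mSu.
    - by move=> w Bw /=; rewrite -(gSE w Bw) ltW// grid_right_gt.
    - exact: ma.
  congr (_ <= _)%E; apply: eq_integral => w /[!inE] Bw.
    by rewrite /f gSE// gdE.
  by rewrite gdE// addrAC subrr add0r.
pose I := (\int[P]_(w in A) (a w ^+ 2 + b ^+ 2 * dt w)%:E)%E.
(* Rounding lengthens the step by at most [1 / (m + 1)], and [P A <= 1], so the error is at most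
   [b ^+ 2 / (m + 1)]. *)
have step' m : (\int[P]_(w in A) f m w <= I + (b ^+ 2 * harmonic m)%:E)%E.
  apply: (le_trans (step m)).
  have c0 : 0 <= b ^+ 2 * harmonic m.
    by rewrite mulr_ge0 ?sqr_ge0// /harmonic/= invr_ge0.
  apply: (@le_trans _ _ (\int[P]_(w in A)
      ((a w ^+ 2 + b ^+ 2 * dt w)%:E + (b ^+ 2 * harmonic m)%:E))%E).
    apply: ge0_le_integral => //.
    - by move=> w _; exact: g0.
    - exact: mg.
    - apply: emeasurable_funD => //; apply: mg; exact: measurable_funTS.
    - move=> w _; rewrite -EFinD lee_fin -addrA lerD2l -mulrDr.
      by rewrite ler_wpM2l ?sqr_ge0// grid_right_le.
  rewrite ge0_integralD//; last 2 first.
  - by move=> w _; exact: g0.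
  - by apply: mg; exact: measurable_funTS.
  - rewrite leeD2l// integral_cst// -[leRHS]mule1 lee_wpmul2l ?lee_fin//.
    exact: probability_le1.
apply: (ge0_integral_le_cvg _ _ f _ _ _ _ mf _ _ step') => //.
- by move=> m w _; rewrite lee_fin sqr_ge0.
- move=> w _; have cS : gS ^~ w @ \oo --> S w by exact: cvg_grid_right.
  have cd : gd ^~ w @ \oo --> dt w by exact: cvg_grid_right.
  have cz : (fun m => a w + b * (W (gS m w + gd m w) w - W (gS m w) w)) @ \oo
      --> a w + b * (W (S w + dt w) w - W (S w) w).
    apply: cvgD; first exact: cvg_cst.
    apply: cvgM; first exact: cvg_cst.
    apply: cvgB; apply: (wiener_path_cvg hW) => //.
    - by move=> m; rewrite addr_ge0.
    - by rewrite addr_ge0.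
    - exact: cvgD.
  by apply: cvg_EFin; [exact: nearW|exact: (cvgM cz cz)].
- rewrite -[X in _ --> X]adde0; apply: cvgeD.
  + by rewrite fin_num_adde_defl.
  + exact: cvg_cst.
  + apply: cvg_EFin; first exact: nearW.
    rewrite -[X in _ --> X](mulr0 (b ^+ 2)).
    by apply: cvgM; [exact: cvg_cst|exact: cvg_harmonic].
Qed.

(** * The adaptive mesh and the splitting scheme *)

(** By monotonicity the admissible indices, those [m >= 1] with t_(m-1) < t, are exactly 1, ..., n
    when [n] is the first index at which the mesh reaches [t]. *)
Lemma mesh_index_eq {Omega : Type} {R : realType} {mesh : nat -> Omega -> R}
    {t : R} {w : Omega} {n : nat} :
  (forall i j, (i <= j)%N -> mesh i w <= mesh j w) ->
  (forall j, (j < n)%N -> mesh j w < t) -> t <= mesh n w ->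
  mesh_index mesh t w = n.
Proof.
move=> mono lt_n ge_n.
have le_n m : (0 < m)%N -> mesh m.-1 w < t -> (m <= n)%N.
  move=> m0; apply: contraTT; rewrite -ltnNge -leNgt => nm.
  by rewrite (le_trans ge_n)// mono// -ltnS prednK.
rewrite /mesh_index; case: n lt_n ge_n le_n => [|n] lt_n ge_n le_n.
  (* For [n = 0] no index is admissible and [xget] returns its default 0, in accordance with N^(0) =
     0. *)
  by apply: xgetPN => m [[m0 mt] _]; have := le_n m m0 mt; rewrite leqNgt m0.
apply: xget_unique => [|m [[m0 mt] mmax]].
  by split; [split => //=; exact: lt_n|move=> m [m0 mt]; exact: le_n].
apply/eqP; rewrite eqn_leq le_n//=; apply: mmax.
by split => //=; exact: lt_n.
Qed.

(** Every positive index is admissible, so there is no largest one and the default is returned. For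
    [t <= T] this concerns a null set of paths, but measurability of the index needs it. *)
Lemma mesh_index_infinite {Omega : Type} {R : realType}
    {mesh : nat -> Omega -> R} {t : R} {w : Omega} :
  (forall n, mesh n w < t) -> mesh_index mesh t w = 0%N.
Proof.
move=> lt_t; apply: xgetPN => m [_ /(_ m.+1)].
by rewrite ltnn => /(_ (conj isT (lt_t m))).
Qed.

Section adaptive_mesh_lemmas.
Context {d} {Omega : measurableType d} {R : realType}.
Context {P : probability Omega R} {W : R -> Omega -> R} {T : R}.
Context {mesh : nat -> Omega -> R}.
Hypothesis hmesh : adaptive_mesh P (natural_filtration W) T mesh.

Lemma mesh_leS n w : mesh n w <= mesh n.+1 w.
Proof.
have := mesh_le_horizon hmesh n w; rewrite le_eqVlt => /predU1P[nT|nT].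
  by rewrite (mesh_after_horizon hmesh nT) nT.
exact/ltW/(mesh_increasing hmesh).
Qed.

Lemma mesh_mono {w i j} : (i <= j)%N -> mesh i w <= mesh j w.
Proof.
move=> ij; rewrite -(subnK ij); elim: (j - i)%N => [|n IH] //.
by rewrite addSn (le_trans IH)// mesh_leS.
Qed.

Lemma mesh_step_ge0 n w : 0 <= mesh_step mesh n w.
Proof. by rewrite subr_ge0 mesh_leS. Qed.

Lemma mesh_index_spec {t w n} : t <= mesh n w ->
  [/\ t <= mesh (mesh_index mesh t w) w &
      forall j, (j < mesh_index mesh t w)%N -> mesh j w < t].
Proof.
move=> tn; have ex : exists m, t <= mesh m w by exists n.
have [m tm mmin] := ex_minnP ex.
have lt_m j : (j < m)%N -> mesh j w < t.
  by move=> jm; rewrite ltNge; apply: contraTN jm; rewrite -leqNgt; exact: mmin.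
by rewrite (@mesh_index_eq _ _ _ _ _ m)// => i j; exact: mesh_mono.
Qed.

(** [X_(n+1)] is a continuous function of [X_n], the step, W(t_n) and W(t_(n+1)). The first three
    are known at t_n, hence at the later time t_(n+1), which is the role of [lift]. *)
Lemma stopped_measurable_scheme (hW : wiener_process P W)
    (kappa theta sigma x0 : R) (n : nat) :
  stopped_measurable W (mesh n)
    (splitting_scheme kappa theta sigma x0 W mesh n).
Proof.
elim: n => [|n IH] u u0; first exact: measurable_cst.
have lift (f : Omega -> R) : stopped_measurable W (mesh n) f ->
    stopped_measurable W (mesh n.+1) f.
  apply: stopped_measurable_le; first exact: (mesh_stopping hmesh).
  exact: mesh_leS.
have mX := lift _ IH u u0.
have mdt := lift _ (stopped_measurable_wrt
  (mesh_step_measurable hmesh n)) u u0.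
have mW := lift _ (stopped_measurable_wiener hW (mesh_stopping hmesh n)) u u0.
have mW1 := stopped_measurable_wiener hW (mesh_stopping hmesh n.+1) u u0.
set D := [set w | mesh n.+1 w <= u] in mX mdt mW mW1 *.
have my : measurable_fun (D : set (past W u))
    (fun w => splitting_scheme kappa theta sigma x0 W mesh n w +
      2 * splitting_alpha kappa theta sigma * mesh_step mesh n w).
  by apply: measurable_funD => //; apply: measurable_funM.
have mdW : measurable_fun (D : set (past W u))
    (fun w => W (mesh n.+1 w) w - W (mesh n w) w).
  exact: measurable_funB.
apply: measurable_funM.
  by apply: measurableT_comp => //; apply: measurable_funM.
apply: measurable_funD; last first.
  by apply: measurable_funM => //; apply: measurable_funX.
apply: measurable_funD => //; apply: measurable_funM => //.
apply: measurable_funM => //; apply: measurableT_comp my.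
by apply: continuous_measurable_fun; exact: sqrt_continuous.
Qed.

End adaptive_mesh_lemmas.

(** * Moment bounds along the splitting scheme *)

Section splitting_moment.
Context {d} {Omega : measurableType d} {R : realType}.
Context {P : probability Omega R} {W : R -> Omega -> R}.
Context {kappa theta sigma x0 T : R} {mesh : nat -> Omega -> R}.
Hypothesis hW : wiener_process P W.
Hypotheses (hkappa : 0 < kappa) (htheta : 0 < theta) (hT : 0 < T).
Hypothesis hmesh : adaptive_mesh P (natural_filtration W) T mesh.
Hypothesis hwd : splitting_well_defined P kappa theta sigma x0 T W mesh.

Local Notation X := (splitting_scheme kappa theta sigma x0 W mesh).
Local Notation dt := (mesh_step mesh).

Lemma measurable_stopped {f : Omega -> R} n :
  stopped_measurable W (mesh n) f -> measurable_fun [set: Omega] f.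
Proof.
apply: (@stopped_measurable_bounded _ _ _ W _ T) => //.
- by move=> t t0; exact: (wiener_measurable hW).
- exact: ltW.
- by move=> w; exact: (mesh_le_horizon hmesh).
Qed.

Lemma measurable_mesh n : measurable_fun [set: Omega] (mesh n).
Proof.
apply: (measurable_stopped n); apply: stopped_measurable_time.
exact: (mesh_stopping hmesh).
Qed.

Lemma measurable_scheme n : measurable_fun [set: Omega] (X n).
Proof.
exact: measurable_stopped (stopped_measurable_scheme hmesh hW _ _ _ _ n).
Qed.

Lemma measurable_mesh_lt n t : measurable [set w | mesh n w < t].
Proof.
rewrite (_ : mkset _ = mesh n @^-1` `]-oo, t[).
  by rewrite -[X in measurable X]setTI; exact: measurable_mesh.
by apply/seteqP; split => w /=; rewrite in_itv.
Qed.

Lemma measurable_mesh_ge n t : measurable [set w | t <= mesh n w].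
Proof.
rewrite (_ : mkset _ = ~` [set w | mesh n w < t]).
  exact/measurableC/measurable_mesh_lt.
apply/seteqP; split => w /=; rewrite leNgt; first by move/negP.
by move=> ?; apply/negP.
Qed.

Lemma measurable_mesh_step n : measurable_fun [set: Omega] (dt n).
Proof. by apply: measurable_funB; exact: measurable_mesh. Qed.

(** Well-definedness holds only almost surely; with absolute values the integrands are non-negative
    on every path, and the scheme is compared with the square only almost everywhere. *)
Lemma scheme_step_moment_le (t : R) (n : nat) : t <= T ->
  (\int[P]_(w in [set w | (mesh n w < t)%R]) (`|X n.+1 w|)%:E <=
   \int[P]_(w in [set w | (mesh n w < t)%R])
     (`|X n w| + kappa * theta * dt n w)%:E)%E.
Proof.
move=> tT; set A := [set w | _].
have [S0 mS] := mesh_stopping hmesh n.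
have mt := stopped_measurable_time (mesh_stopping hmesh n).
have mdt : stopped_measurable W (mesh n) (dt n).
  exact: stopped_measurable_wrt (mesh_step_measurable hmesh n).
have mX : stopped_measurable W (mesh n) (X n).
  exact: stopped_measurable_scheme hmesh hW _ _ _ _ n.
pose y w := X n w + 2 * splitting_alpha kappa theta sigma * dt n w.
pose a w := Num.sqrt (y w).
have my : stopped_measurable W (mesh n) y.
  move=> u u0; apply: measurable_funD; first exact: mX.
  by apply: measurable_funM => //; exact: mdt.
have msqrt : measurable_fun [set: R] (@Num.sqrt R).
  by apply: continuous_measurable_fun; exact: sqrt_continuous.
have ma : stopped_measurable W (mesh n) a.
  by move=> u u0; apply: measurableT_comp (my u u0).
have mA : measurable A by exact: measurable_mesh_lt.
have mAu u : 0 <= u -> natural_filtration W u ([set w | mesh n w <= u] `&` A).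
  move=> u0; rewrite (_ : A = mesh n @^-1` `]-oo, t[).
    by apply: (mt u u0) => //; exact: mS.
  by apply/seteqP; split => w /=; rewrite in_itv.
have wd : {ae P, forall w, A w -> 0 <= y w}.
  by apply: filterS hwd => w h Aw; apply: h; exact: lt_le_trans tT.
have mW1 : measurable_fun [set: Omega]
    (fun w => W (mesh n w + dt n w) w - W (mesh n w) w).
  apply: measurable_funB.
    under eq_fun do rewrite /mesh_step addrC subrK.
    apply: (measurable_stopped n.+1).
    exact (stopped_measurable_wiener hW (mesh_stopping hmesh n.+1)).
  apply: (measurable_stopped n).
  exact (stopped_measurable_wiener hW (mesh_stopping hmesh n)).
have ma' := measurable_stopped _ ma.
have dt0 w : 0 <= dt n w by exact: (mesh_step_ge0 hmesh).
have kt0 : 0 <= kappa * theta by rewrite mulr_ge0 ?ltW.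
apply: (@le_trans _ _ (\int[P]_(w in A)
   ((a w + sigma / 2 * (W (mesh n w + dt n w) w - W (mesh n w) w)) ^+ 2)%:E)%E).
  apply: ae_ge0_le_integral => //.
  - by apply/measurable_EFinP/measurableT_comp => //; apply: measurable_funTS;
      exact: measurable_scheme.
  - by move=> w _; rewrite lee_fin sqr_ge0.
  - apply: measurable_funTS; apply/measurable_EFinP; apply: measurable_funX.
    by apply: measurable_funD => //; exact: measurable_funM.
  apply: filterS wd => w + Aw => /(_ Aw) y0.
  rewrite lee_fin /= -/(y w).
  have -> : mesh n.+1 w = mesh n w + dt n w.
    by rewrite /mesh_step addrC subrK.
  set dW := W _ w - _.
  (* Completing the square uses [0 <= y w], through [y w = Num.sqrt (y w) ^+ 2]. The exponential
     factor is then bounded by 1. *)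
  have -> : y w + sigma * Num.sqrt (y w) * dW + sigma ^+ 2 / 4 * dW ^+ 2 =
      (a w + sigma / 2 * dW) ^+ 2.
    by rewrite -[X in X + _ + _](sqr_sqrtr y0) -/(a w); field.
  rewrite ger0_norm; last by rewrite mulr_ge0 ?expR_ge0 ?sqr_ge0.
  rewrite ler_piMl ?sqr_ge0// -expR0 ler_expR mulNr oppr_le0.
  by rewrite (mulr_ge0 (ltW hkappa)).
apply: (@le_trans _ _ (\int[P]_(w in A)
    (a w ^+ 2 + (sigma / 2) ^+ 2 * dt n w)%:E)%E).
  exact: (stopped_increment_second_moment_le hW
    (mesh_stopping hmesh n) (ltW hT) (mesh_le_horizon hmesh n) dt0 mdt ma mAu).
have mdt' := measurable_mesh_step n.
apply: ae_ge0_le_integral => //.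
- by move=> w _; rewrite lee_fin addr_ge0 ?sqr_ge0// mulr_ge0 ?sqr_ge0.
- apply: measurable_funTS; apply/measurable_EFinP; apply: measurable_funD.
    exact: measurable_funX.
  exact: measurable_funM.
- by move=> w _; rewrite lee_fin addr_ge0// mulr_ge0.
- apply: measurable_funTS; apply/measurable_EFinP; apply: measurable_funD.
    by apply: measurableT_comp => //; exact: measurable_scheme.
  exact: measurable_funM.
apply: filterS wd => w + Aw => /(_ Aw) y0.
rewrite lee_fin /a sqr_sqrtr// /y.
(* The coefficients of [dt] add up exactly: [2 * alpha = kappa * theta - sigma ^+ 2 / 4], and the
   variance term contributes [(sigma / 2) ^+ 2]. *)
have := ler_norm (X n w).
rewrite /splitting_alpha => ?; nra.
Qed.

(* |X_(min n N)|, where N = N^(t) *)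
Fixpoint abs_scheme_until (t : R) (n : nat) (w : Omega) : R :=
  if n is k.+1 then
    if mesh k w < t then `|X k.+1 w| else abs_scheme_until t k w
  else `|X 0 w|.

Lemma abs_scheme_untilE {t n w} : (forall j, (j < n)%N -> mesh j w < t) ->
  abs_scheme_until t n w = `|X n w|.
Proof. by case: n => [//|n] /(_ n (ltnSn n)) /= ->. Qed.

Lemma abs_scheme_until_stable {t n m w} : t <= mesh n w -> (n <= m)%N ->
  abs_scheme_until t m w = abs_scheme_until t n w.
Proof.
move=> tn nm; rewrite -(subnK nm); elim: (m - n)%N => [//|k IH] /=.
by rewrite ltNge (le_trans tn (mesh_mono hmesh (leq_addl _ _))).
Qed.

Lemma abs_scheme_until_ge0 t n w : 0 <= abs_scheme_until t n w.
Proof. by elim: n => [|n IH] /=; [|case: ifP]. Qed.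

Lemma measurable_abs_scheme_until t n :
  measurable_fun [set: Omega] (abs_scheme_until t n).
Proof.
elim: n => [|n IH].
  by have -> : abs_scheme_until t 0 = cst `|x0| by [].
have -> : abs_scheme_until t n.+1 = (fun w =>
  if mesh n w < t then `|X n.+1 w| else abs_scheme_until t n w) by [].
apply: measurable_fun_ifT => //.
  by apply: measurable_fun_ltr => //; exact: measurable_mesh.
by apply: measurableT_comp => //; exact: measurable_scheme.
Qed.

Lemma abs_scheme_until_moment_le {t : R} (n : nat) : t <= T ->
  (\int[P]_w (abs_scheme_until t n w)%:E <=
   \int[P]_w (`|x0| + kappa * theta * mesh n w)%:E)%E.
Proof.
move=> tT; have kt0 : 0 <= kappa * theta by rewrite mulr_ge0 ?ltW.
elim: n => [|n IH].
  rewrite le_eqVlt; apply/orP; left; apply/eqP; apply: eq_integral => w _ /=.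
  by rewrite (mesh_start hmesh) mulr0 addr0.
have mY := measurable_abs_scheme_until t.
have Y0 := abs_scheme_until_ge0 t.
have dt0 w : 0 <= dt n w by exact: (mesh_step_ge0 hmesh).
have mdt := measurable_mesh_step n.
pose G w := (abs_scheme_until t n w + kappa * theta * dt n w)%:E.
have G0 w : (0 <= G w)%E by rewrite lee_fin addr_ge0// mulr_ge0.
have mG : measurable_fun [set: Omega] G.
  by apply/measurable_EFinP; apply: measurable_funD => //;
    exact: measurable_funM.
apply: (@le_trans _ _ (\int[P]_w G w)%E).
  pose A := [set w | mesh n w < t].
  have mA : measurable A by exact: measurable_mesh_lt.
  have splitA (h : Omega -> \bar R) : measurable_fun [set: Omega] h ->
      (forall w, (0 <= h w)%E) ->
      (\int[P]_w h w = \int[P]_(w in A) h w + \int[P]_(w in ~` A) h w)%E.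
    move=> mh h0; rewrite -(setvU A) addeC -ge0_integral_setU ?setvU//.
      exact: measurableC.
    exact/disj_setPCr.
  rewrite !splitA//; last 2 first.
  - exact/measurable_EFinP.
  - by move=> w; rewrite lee_fin.
  apply: leeD.
    have -> : (\int[P]_(w in A) (abs_scheme_until t n.+1 w)%:E =
        \int[P]_(w in A) (`|X n.+1 w|)%:E)%E.
      by apply: eq_integral => w /[!inE] /= ->.
    have -> : (\int[P]_(w in A) G w =
        \int[P]_(w in A) (`|X n w| + kappa * theta * dt n w)%:E)%E.
      apply: eq_integral => w /[!inE] Aw; rewrite /G.
      rewrite abs_scheme_untilE// => j jn.
      exact: le_lt_trans (mesh_mono hmesh (ltnW jn)) Aw.
    exact: scheme_step_moment_le.
  apply: ge0_le_integral => //.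
  - exact: measurableC.
  - by move=> w _; rewrite lee_fin.
  - by apply: measurable_funTS; exact/measurable_EFinP.
  - exact: measurable_funTS.
  - move=> w /= /negP/negbTE ->.
    by rewrite lee_fin lerDl mulr_ge0.
have mm := measurable_mesh.
have S0 k w : 0 <= mesh k w by case: (mesh_stopping hmesh k).
(* The integral of [G] is split so that the induction hypothesis can replace one summand, and is
   then reassembled with [mesh n + dt n = mesh n.+1]. *)
have -> : (\int[P]_w G w = \int[P]_w (abs_scheme_until t n w)%:E +
    \int[P]_w (kappa * theta * dt n w)%:E)%E.
  rewrite -ge0_integralD//.
  - by move=> w _; rewrite lee_fin.
  - exact/measurable_EFinP.
  - by move=> w _; rewrite lee_fin mulr_ge0.
  - by apply/measurable_EFinP; exact: measurable_funM.
apply: (le_trans (leeD IH (lexx _))).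
rewrite -ge0_integralD//; last 4 first.
- by move=> w _; rewrite lee_fin addr_ge0// mulr_ge0.
- by apply/measurable_EFinP; apply: measurable_funD => //;
   exact: measurable_funM.
- by move=> w _; rewrite lee_fin mulr_ge0.
- by apply/measurable_EFinP; exact: measurable_funM.
rewrite le_eqVlt; apply/orP; left; apply/eqP; apply: eq_integral => w _ /=.
by rewrite -EFinD -addrA -mulrDr /mesh_step [mesh n w + _]addrC subrK.
Qed.

Lemma abs_scheme_index_moment_le {t : R} : 0 <= x0 -> t <= T ->
  (\int[P]_(w in \bigcup_n [set w | (t <= mesh n w)%R])
     (`|X (mesh_index mesh t w) w|)%:E <= (x0 + kappa * theta * T)%:E)%E.
Proof.
move=> x00 tT; set D := \bigcup_n _.
have mD : measurable D.
  by apply: bigcup_measurable => n _; exact: measurable_mesh_ge.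
have kt0 : 0 <= kappa * theta by rewrite mulr_ge0 ?ltW.
apply: (@ge0_integral_le_cvg _ _ _ P D
    (fun n w => (abs_scheme_until t n w)%:E) _
    (fun _ => (x0 + kappa * theta * T)%:E)) => //.
- move=> n; apply: measurable_funTS; apply/measurable_EFinP.
  exact: measurable_abs_scheme_until.
- by move=> n w _; rewrite lee_fin abs_scheme_until_ge0.
- move=> w [n _ /= tn].
  have [tN ltN] := mesh_index_spec hmesh tn.
  apply: cvg_near_cst; exists (mesh_index mesh t w) => // m /= Nm.
  by rewrite (abs_scheme_until_stable tN Nm) abs_scheme_untilE.
- move=> n; have S0 w : 0 <= mesh n w by case: (mesh_stopping hmesh n).
  apply: (@le_trans _ _ (\int[P]_w (abs_scheme_until t n w)%:E)%E).
    apply: ge0_subset_integral => //.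
    + by apply/measurable_EFinP; exact: measurable_abs_scheme_until.
    + by move=> w _; rewrite lee_fin abs_scheme_until_ge0.
  apply: (le_trans (abs_scheme_until_moment_le _ tT)).
  apply: (@le_trans _ _ (\int[P]_w (cst (x0 + kappa * theta * T)%:E w))%E).
    apply: ge0_le_integral => //.
    + by move=> w _; rewrite lee_fin addr_ge0// mulr_ge0.
    + apply/measurable_EFinP; apply: measurable_funD => //.
      by apply: measurable_funM => //; exact: measurable_mesh.
    + move=> w _; rewrite lee_fin ger0_norm// lerD2l ler_wpM2l//.
      exact: (mesh_le_horizon hmesh).
  by rewrite integral_cst//= probability_setT mule1.
- exact: cvg_cst.
Qed.

(** It suffices that the index has measurable fibres. These are the first-passage events [B i]; the
    event [C] that [t] is never reached joins the fibre over 0, because of the default value. *)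
Lemma measurable_scheme_index (t : R) :
  measurable_fun [set: Omega] (fun w => X (mesh_index mesh t w) w).
Proof.
apply: (measurable_fun_nat_index setT (mesh_index mesh t) X); last first.
  by move=> i; apply: measurable_funTS; exact: measurable_scheme.
have mlt n := measurable_mesh_lt n t.
pose B i := ~` [set w | mesh i w < t] `&`
  \bigcap_(j in [set j | (j < i)%N]) [set w | mesh j w < t].
have mB i : measurable (B i).
  apply: measurableI; first exact: measurableC.
  exact: bigcap_measurableType.
have BE i w : B i w -> mesh_index mesh t w = i.
  move=> [/= /negP]; rewrite -leNgt => ti lti.
  by apply: mesh_index_eq => // ? ?; exact: (mesh_mono hmesh).
pose C := \bigcap_n [set w | mesh n w < t].
have mC : measurable C by apply: bigcapT_measurable.
have CE w : C w -> mesh_index mesh t w = 0%N.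
  by move=> Cw; apply: mesh_index_infinite => n; exact: Cw.
move=> i; rewrite setTI.
have -> : mesh_index mesh t @^-1` [set i] =
    B i `|` (if i is 0%N then C else set0).
  apply/seteqP; split => w; last first.
    by move=> [/BE//|]; case: (i) => [/CE|].
  move=> /= wi; have [Cw|nCw] := pselect (C w).
    by right; rewrite -wi CE.
  left; have [n tn] : exists n, t <= mesh n w.
    apply: contrapT => nex; apply: nCw => n _ /=; rewrite ltNge.
    by apply/negP => tn; apply: nex; exists n.
  have [tN ltN] := mesh_index_spec hmesh tn.
  by rewrite -wi; split => [/=|//]; apply/negP; rewrite -leNgt.
by apply: measurableU => //; case: (i).
Qed.

End splitting_moment.

(** * From |X_N| on the paths that reach [t] to the expectation of X_N *)

Theorem theorem12 (d : measure_display) (Omega : measurableType d)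
  (R : realType) (P : probability Omega R) (W : R -> Omega -> R)
  (kappa theta sigma x0 T dtmax : R) (mesh : nat -> Omega -> R)
  (hW : wiener_process P W)
  (hkappa : 0 < kappa) (htheta : 0 < theta) (hsigma : 0 < sigma)
  (hx0 : 0 < x0) (hT : 0 < T)
  (hmesh : adaptive_mesh P (natural_filtration W) T mesh)
  (hdtmax : forall n w, mesh n w < T -> mesh_step mesh n w <= dtmax)
  (hwd : splitting_well_defined P kappa theta sigma x0 T W mesh) :
  forall t : R, 0 <= t -> t <= T ->
  ('E_P[fun w => splitting_scheme kappa theta sigma x0 W mesh
                   (mesh_index mesh t w) w]
     <= (x0 + kappa * theta * T)%:E)%E.
Proof.
move=> t t0 tT; rewrite unlock.
pose X w :=
  splitting_scheme kappa theta sigma x0 W mesh (mesh_index mesh t w) w.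
have mX : measurable_fun [set: Omega] X.
  exact: (measurable_scheme_index hW hT hmesh).
pose D := \bigcup_n [set w | t <= mesh n w].
have mD : measurable D.
  apply: bigcup_measurable => n _.
  exact: (measurable_mesh_ge hW hT hmesh).
apply: (@le_trans _ _ (\int[P]_(w in D) (`|X w|)%:E)%E); last first.
  exact: (abs_scheme_index_moment_le hW hkappa htheta hT hmesh hwd (ltW hx0)).
have mabs : measurable_fun [set: Omega] (fun w => (`|X w|)%:E).
  by apply/measurable_EFinP; exact: measurableT_comp.
change (\int[P]_w (X w)%:E <= \int[P]_(w in D) (`|X w|)%:E)%E.
(* The integral is that of the positive part minus that of the negative part. Dropping the latter
   gives an upper bound without integrability of [X]. *)
rewrite integralE; set I := (X in (X - _)%E).
apply: (@le_trans _ _ I).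
  by rewrite -[leRHS]sube0 leeB// integral_ge0.
rewrite [leRHS]integral_mkcond; apply: ae_ge0_le_integral => //.
- by apply: measurable_funepos; exact/measurable_EFinP.
- by move=> w _; apply: erestrict_ge0 => w' _; rewrite lee_fin.
- by apply/(measurable_restrictT _ mD); exact: measurable_funTS.
(* Almost every path reaches [T >= t], hence lies in [D], where the positive part of [X] is at most
   its absolute value. *)
apply: filterS (mesh_finite hmesh) => w [n nT] _.
rewrite patchE mem_set; last by exists n => //=; rewrite nT.
by rewrite funeposE ge_max !lee_fin ler_norm normr_ge0.
Qed.
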